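(* There are constants $c,d$ such that for every $n\ge1$ there is a $\mathbf{PC}^=$-proof $\pi_n$ of $\forall\boldsymbol{\lambda}\mathbf I\to(\forall x.\,px=p(qx))\to E_n$ with $\mathrm{cc}(\pi_n)\le c\cdot n+d$.
   Context: Language: a left-associative binary function symbol $\circ$ (application, written as juxtaposition), constants $S,B,C,I,p,q$, equality. $\boldsymbol{\lambda}\mathbf I$ is the set of equations $Sxyz=xz(yz)$, $Bxyz=x(yz)$, $Cxyz=xzy$, $Ix=x$; $\forall\boldsymbol{\lambda}\mathbf I$ is the set of their universal closures, and $\{A_1,\dots,A_m\}\to F$ means $A_1\to\dots\to A_m\to F$. $T:=SB(CBI)$, $T_1:=T$, $T_{n+1}:=T_nT$, $E_n:=\ pq=p(T_nqq)$. $\mathbf{PC}^=$ is the Hilbert-style predicate calculus with equality: initial formulas are propositional tautologies, $\forall xA(x)\to A(t)$ ($\forall^-$), $A(t)\to\exists xA(x)$ ($\exists^+$), and the equality axioms $t=t$, $s=t\to t=s$, $s=t\to t=u\to s=u$, $\vec s=\vec t\to f\vec s=f\vec t$, $\vec s=\vec t\to P\vec s\to P\vec t$; rules are modus ponens, from $A\to B(a)$ infer $A\to\forall xB(x)$, and from $A(a)\to B$ infer $\exists xA(x)\to B$ (eigenvariable $a$ not in the conclusion). The critical count $\mathrm{cc}(\pi)$ is the number of instances of $\forall^-$ and $\exists^+$ in $\pi$. *)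

(* Defs.v *)
From Stdlib Require Import List Arith Bool.
Import ListNotations.

Inductive constant : Set := cS | cB | cC | cI | cp | cq.

(* Locally nameless syntax: [Free a] is a free variable (the possible
   eigenvariables), [Bound i] a de Bruijn index pointing to the i-th enclosing
   quantifier, so formulas are identified up to renaming of bound variables. *)
Inductive term : Set :=
| Free (a : nat)
| Bound (i : nat)
| Const (c : constant)
| App (s t : term).

Coercion Const : constant >-> term.

Inductive formula : Set :=
| Eq (s t : term)
| Neg (A : formula)
| And (A B : formula)
| Or (A B : formula)
| Imp (A B : formula)
| All (A : formula)
| Ex (A : formula).

Declare Scope fo_scope.
Delimit Scope fo_scope with fo.
Bind Scope fo_scope with term formula.
Notation "s ∘ t" := (App s t) (at level 40, left associativity) : fo_scope.
Notation "s ≐ t" := (Eq s t) (at level 70, no associativity) : fo_scope.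
Notation "A ⊃ B" := (Imp A B) (at level 85, right associativity) : fo_scope.
Open Scope fo_scope.

(* [lc_* k]: every de Bruijn index is bound, up to k outer quantifiers.  The
   terms and formulas of the object language are those with k = 0. *)
Fixpoint lc_term (k : nat) (t : term) : Prop :=
  match t with
  | Bound i => i < k
  | App s t => lc_term k s /\ lc_term k t
  | Free _ | Const _ => True
  end.

Fixpoint lc_formula (k : nat) (A : formula) : Prop :=
  match A with
  | Eq s t => lc_term k s /\ lc_term k t
  | Neg A => lc_formula k A
  | And A B | Or A B | Imp A B => lc_formula k A /\ lc_formula k B
  | All A | Ex A => lc_formula (S k) A
  end.

Fixpoint occurs_term (a : nat) (t : term) : Prop :=
  match t with
  | Free b => a = b
  | App s t => occurs_term a s \/ occurs_term a t
  | Bound _ | Const _ => False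
  end.

Fixpoint occurs (a : nat) (A : formula) : Prop :=
  match A with
  | Eq s t => occurs_term a s \/ occurs_term a t
  | Neg A => occurs a A
  | And A B | Or A B | Imp A B => occurs a A \/ occurs a B
  | All A | Ex A => occurs a A
  end.

Fixpoint subst_term (k : nat) (u t : term) : term :=
  match t with
  | Bound i => if Nat.eqb i k then u else t
  | App s t => subst_term k u s ∘ subst_term k u t
  | Free _ | Const _ => t
  end.

Fixpoint subst (k : nat) (u : term) (A : formula) : formula :=
  match A with
  | Eq s t => subst_term k u s ≐ subst_term k u t
  | Neg A => Neg (subst k u A)
  | And A B => And (subst k u A) (subst k u B)
  | Or A B => Or (subst k u A) (subst k u B)
  | Imp A B => subst k u A ⊃ subst k u B
  | All A => All (subst (S k) u A)
  | Ex A => Ex (subst (S k) u A)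
  end.

(* A(u), where A(x) is the body of the quantified formulas [All A], [Ex A].
   Capture-free only when [u] is locally closed ([lc_term 0 u]). *)
Definition inst (A : formula) (u : term) : formula := subst 0 u A.

(* The prime formulas of propositional logic are the equations and the
   quantified formulas. *)
Fixpoint eval_prop (v : formula -> bool) (A : formula) : bool :=
  match A with
  | Eq _ _ | All _ | Ex _ => v A
  | Neg A => negb (eval_prop v A)
  | And A B => eval_prop v A && eval_prop v B
  | Or A B => eval_prop v A || eval_prop v B
  | Imp A B => implb (eval_prop v A) (eval_prop v B)
  end.

Definition tautology (A : formula) : Prop :=
  forall v : formula -> bool, eval_prop v A = true.

(* The congruence axioms are those of the only proper function symbol and the
   only predicate symbol; for constants they are instances of reflexivity. *)
Inductive equality_axiom : formula -> Prop :=
| eq_refl_ax t : equality_axiom (t ≐ t)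
| eq_sym_ax s t : equality_axiom (s ≐ t ⊃ t ≐ s)
| eq_trans_ax s t u : equality_axiom (s ≐ t ⊃ t ≐ u ⊃ s ≐ u)
| eq_app_ax s1 s2 t1 t2 :
    equality_axiom (s1 ≐ t1 ⊃ s2 ≐ t2 ⊃ s1 ∘ s2 ≐ t1 ∘ t2)
| eq_eq_ax s1 s2 t1 t2 :
    equality_axiom (s1 ≐ t1 ⊃ s2 ≐ t2 ⊃ s1 ≐ s2 ⊃ t1 ≐ t2).

Inductive rule : Set :=
| r_taut | r_all_elim | r_ex_intro | r_equality | r_mp | r_all | r_ex.

Inductive justified (prev : list formula) : rule -> formula -> Prop :=
| j_taut A : tautology A -> justified prev r_taut A
| j_all_elim A t : lc_term 0 t -> justified prev r_all_elim (All A ⊃ inst A t)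
| j_ex_intro A t : lc_term 0 t -> justified prev r_ex_intro (inst A t ⊃ Ex A)
| j_equality A : equality_axiom A -> justified prev r_equality A
| j_mp A B : In A prev -> In (A ⊃ B) prev -> justified prev r_mp B
| j_all A B a :
    In (A ⊃ inst B (Free a)) prev -> ~ occurs a (A ⊃ All B) ->
    justified prev r_all (A ⊃ All B)
| j_ex A B a :
    In (inst A (Free a) ⊃ B) prev -> ~ occurs a (Ex A ⊃ B) ->
    justified prev r_ex (Ex A ⊃ B).

Definition proof : Set := list (rule * formula).

Definition is_proof (pi : proof) : Prop :=
  forall i r A, nth_error pi i = Some (r, A) ->
    lc_formula 0 A /\ justified (map snd (firstn i pi)) r A.

Definition proves (pi : proof) (A : formula) : Prop :=
  is_proof pi /\ exists pi' r, pi = pi' ++ [(r, A)].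

Definition critical (r : rule) : bool :=
  match r with r_all_elim | r_ex_intro => true | _ => false end.

Definition cc (pi : proof) : nat :=
  length (filter (fun l => critical (fst l)) pi).

(* {A_1, ..., A_m} -> F *)
Definition imp_list (G : list formula) (F : formula) : formula :=
  fold_right Imp F G.

Definition all_lambdaI : list formula :=
  [ (* x, y, z = Bound 2, 1, 0 *)
    All (All (All (cS ∘ Bound 2 ∘ Bound 1 ∘ Bound 0
                   ≐ Bound 2 ∘ Bound 0 ∘ (Bound 1 ∘ Bound 0))));
    All (All (All (cB ∘ Bound 2 ∘ Bound 1 ∘ Bound 0
                   ≐ Bound 2 ∘ (Bound 1 ∘ Bound 0))));
    All (All (All (cC ∘ Bound 2 ∘ Bound 1 ∘ Bound 0
                   ≐ Bound 2 ∘ Bound 0 ∘ Bound 1)));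
    All (cI ∘ Bound 0 ≐ Bound 0) ].

Definition T : term := cS ∘ cB ∘ (cC ∘ cB ∘ cI).

(* Meaningful for n >= 1; the value at 0 is a dummy. *)
Fixpoint Tn (n : nat) : term :=
  match n with
  | 0 | 1 => T
  | S m => Tn m ∘ T
  end.

Definition E (n : nat) : formula := cp ∘ cq ≐ cp ∘ (Tn n ∘ cq ∘ cq).

Definition p_invariant : formula := All (cp ∘ Bound 0 ≐ cp ∘ (cq ∘ Bound 0)).

(* Main.v *)
(** The combinator [T] is the Church numeral 2, so [Tn n] is a tower of [n]
    twos, and unfolding [Tn n ∘ q ∘ q] would take far too many equations.
    Instead, call [y] hereditary of level [0] when [p x = p (y x)] for all [x],
    and of level [k + 1] when every [z = y x] with [x] hereditary of level [k]
    is hereditary of level [k].  The quantified [z] makes each positive level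
    provably closed under equality without an induction on [k].  Since
    [T y x = y (y x)], it follows that [T] is hereditary of every positive
    level, at a cost that does not depend on the level.  The left factor of
    [T T] at level [k + 1] and the right one at level [k] make [T T] hereditary
    of level [k], and so on: [Tn n] has every positive level at a cost linear
    in [n].  As [q] has level [0], so has [Tn n ∘ q], and instantiating with
    [q] gives [E n]. *)

From Stdlib Require Import List Arith Bool Lia.
Require Import Defs.
Import ListNotations.

Lemma lc_term_le k k' t : k <= k' -> lc_term k t -> lc_term k' t.
Proof. induction t; simpl; [tauto|lia|tauto|tauto]. Qed.

Lemma subst_term_lc k u t : lc_term k t -> subst_term k u t = t.
Proof.
  induction t as [a|i|c|s IHs t IHt]; simpl; intro lc_t; try reflexivity.
  - destruct (Nat.eqb_spec i k); [lia|reflexivity].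
  - now rewrite IHs, IHt.
Qed.

Lemma subst_closed_term k u t : lc_term 0 t -> subst_term k u t = t.
Proof. intro lc_t; apply subst_term_lc, lc_term_le with 0; [lia|assumption]. Qed.

Lemma lc_subst_term k u t :
  lc_term 0 u -> lc_term k (subst_term k u t) <-> lc_term (S k) t.
Proof.
  intro lc_u; induction t as [a|i|c|s IHs t IHt]; simpl; [tauto| |tauto|tauto].
  destruct (Nat.eqb_spec i k) as [->|i_neq_k]; simpl; [|lia].
  split; intros _; [lia|]. apply lc_term_le with 0; [lia|assumption].
Qed.

Lemma lc_subst u A : lc_term 0 u ->
  forall k, lc_formula k (subst k u A) <-> lc_formula (S k) A.
Proof.
  intro lc_u; induction A as [s t|A IH|A IHA B IHB|A IHA B IHB|A IHA B IHB
    |A IH|A IH]; intro k; simpl; rewrite ?lc_subst_term by assumption;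
    try rewrite IH; try rewrite IHA, IHB; reflexivity.
Qed.

Fixpoint lift (t : term) : term :=
  match t with
  | Bound i => Bound (S i)
  | App s t => lift s ∘ lift t
  | Free _ | Const _ => t
  end.

Lemma lc_lift k t : lc_term (S k) (lift t) <-> lc_term k t.
Proof. induction t; simpl; [tauto|lia|tauto|tauto]. Qed.

Lemma lift_lc t : lc_term 0 t -> lift t = t.
Proof.
  induction t as [a|i|c|s IHs t IHt]; simpl; intro lc_t; try reflexivity; [lia|].
  now rewrite IHs, IHt.
Qed.

Lemma subst_lift k u t :
  lc_term 0 u -> subst_term (S k) u (lift t) = lift (subst_term k u t).
Proof.
  intro lc_u; induction t as [a|i|c|s IHs t IHt]; simpl; try reflexivity.
  - destruct (Nat.eqb i k); [now rewrite lift_lc|reflexivity].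
  - now rewrite IHs, IHt.
Qed.

Lemma occurs_term_bounded t : exists n, forall a, occurs_term a t -> a < n.
Proof.
  induction t as [a|i|c|s [m bound_s] t [n bound_t]]; simpl.
  - exists (S a); lia.
  - now exists 0.
  - now exists 0.
  - exists (Nat.max m n); intros a [in_s|in_t];
      [apply bound_s in in_s|apply bound_t in in_t]; lia.
Qed.

Lemma occurs_bounded A : exists n, forall a, occurs a A -> a < n.
Proof.
  induction A as [s t|A IH|A [m bound_A] B [n bound_B]
    |A [m bound_A] B [n bound_B]|A [m bound_A] B [n bound_B]|A IH|A IH];
    simpl; [|exact IH| | | |exact IH|exact IH].
  1: destruct (occurs_term_bounded s) as [m bound_A],
       (occurs_term_bounded t) as [n bound_B].
  all: exists (Nat.max m n); intros a [in_A|in_B];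
    [apply bound_A in in_A|apply bound_B in in_B]; lia.
Qed.

Lemma fresh_variable A : exists a, ~ occurs a A.
Proof.
  destruct (occurs_bounded A) as [n bound]; exists n; intro n_in_A.
  apply bound in n_in_A; lia.
Qed.

(** * Derivability with a bounded critical count *)

Lemma justified_incl prev prev' r A :
  incl prev prev' -> justified prev r A -> justified prev' r A.
Proof.
  intros prev_incl just; destruct just as [| | | |A B|A B a|A B a].
  1-4: now constructor.
  - apply j_mp with A; now apply prev_incl.
  - apply j_all with a; [now apply prev_incl|assumption].
  - apply j_ex with a; [now apply prev_incl|assumption].
Qed.

Lemma is_proof_nil : is_proof [].
Proof. now intros [|i]. Qed.

Lemma is_proof_snoc pi r A :
  is_proof (pi ++ [(r, A)]) <->
  is_proof pi /\ lc_formula 0 A /\ justified (map snd pi) r A.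
Proof.
  assert (prefix : forall i, i <= length pi ->
    firstn i (pi ++ [(r, A)]) = firstn i pi).
  { intros i i_le; rewrite firstn_app.
    now rewrite (proj2 (Nat.sub_0_le _ _) i_le), app_nil_r. }
  split.
  - intro proof_snoc; split.
    + intros i r' A' nth_i.
      assert (i < length pi) by (apply nth_error_Some; congruence).
      rewrite <- (prefix i) by lia.
      apply proof_snoc; now rewrite nth_error_app1.
    + rewrite <- (firstn_all pi), <- prefix by lia.
      apply proof_snoc; now rewrite nth_error_app2, Nat.sub_diag.
  - intros (proof_pi & lc_A & just_A) i r' A' nth_i.
    destruct (Nat.lt_ge_cases i (length pi)) as [i_lt|i_ge].
    + rewrite prefix by lia; apply proof_pi.
      now rewrite nth_error_app1 in nth_i.
    + rewrite nth_error_app2 in nth_i by assumption.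
      destruct (i - length pi) as [|j] eqn:i_eq; [|destruct j; discriminate].
      injection nth_i as <- <-.
      replace i with (length pi) by lia.
      now rewrite prefix, firstn_all.
Qed.

Lemma is_proof_app pi1 pi2 :
  is_proof pi1 -> is_proof pi2 -> is_proof (pi1 ++ pi2).
Proof.
  intro proof1; induction pi2 as [|[r A] pi2 IH] using rev_ind; intro proof2.
  - now rewrite app_nil_r.
  - apply is_proof_snoc in proof2 as (proof2 & lc_A & just_A).
    rewrite app_assoc; apply is_proof_snoc; split; [now apply IH|].
    split; [assumption|].
    apply justified_incl with (2 := just_A); rewrite map_app.
    apply incl_appr, incl_refl.
Qed.

Lemma proves_snoc pi r A :
  is_proof pi -> lc_formula 0 A -> justified (map snd pi) r A ->
  proves (pi ++ [(r, A)]) A.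
Proof. intros; split; [now apply is_proof_snoc|eauto]. Qed.

Lemma proves_lc pi A : proves pi A -> lc_formula 0 A.
Proof.
  intros [proof_pi (pi' & r & ->)]; now apply is_proof_snoc in proof_pi.
Qed.

Lemma proves_In pi A : proves pi A -> In A (map snd pi).
Proof.
  intros [_ (pi' & r & ->)].
  rewrite map_app; apply in_or_app; right; now left.
Qed.

Lemma cc_app pi1 pi2 : cc (pi1 ++ pi2) = cc pi1 + cc pi2.
Proof. unfold cc; now rewrite filter_app, length_app. Qed.

Definition derivable (m : nat) (A : formula) : Prop :=
  exists pi, proves pi A /\ cc pi <= m.

Lemma derivable_lc m A : derivable m A -> lc_formula 0 A.
Proof. intros (pi & proves_A & _); exact (proves_lc _ _ proves_A). Qed.

Lemma derivable_le m m' A : m <= m' -> derivable m A -> derivable m' A.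
Proof. intros m_le (pi & proves_A & cc_pi); exists pi; split; [easy|lia]. Qed.

Lemma derivable_axiom r A :
  lc_formula 0 A -> justified [] r A -> derivable (cc [(r, A)]) A.
Proof.
  intros lc_A just_A; exists ([] ++ [(r, A)]); split; [|reflexivity].
  now apply proves_snoc; [apply is_proof_nil|..].
Qed.

Lemma derivable_mp m n A B :
  derivable m (A ⊃ B) -> derivable n A -> derivable (m + n) B.
Proof.
  intros (pi1 & proves_AB & cc_pi1) (pi2 & proves_A & cc_pi2).
  exists ((pi1 ++ pi2) ++ [(r_mp, B)]); split.
  - apply proves_snoc.
    + apply is_proof_app; [apply proves_AB|apply proves_A].
    + exact (proj2 (proves_lc _ _ proves_AB)).
    + apply j_mp with A; rewrite map_app; apply in_or_app;
        [right|left]; now apply proves_In.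
  - rewrite !cc_app; change (cc [(r_mp, B)]) with 0; lia.
Qed.

Lemma derivable_all m A B a :
  lc_formula 0 (A ⊃ All B) -> ~ occurs a (A ⊃ All B) ->
  derivable m (A ⊃ inst B (Free a)) -> derivable m (A ⊃ All B).
Proof.
  intros lc_AB a_fresh (pi & proves_A & cc_pi).
  exists (pi ++ [(r_all, A ⊃ All B)]); split.
  - apply proves_snoc; [apply proves_A|assumption|].
    apply j_all with a; [now apply proves_In|assumption].
  - rewrite cc_app; change (cc [(r_all, A ⊃ All B)]) with 0; lia.
Qed.

Lemma derivable_consequence m A B :
  lc_formula 0 B -> tautology (A ⊃ B) -> derivable m A -> derivable m B.
Proof.
  intros lc_B taut_AB der_A; apply (derivable_mp 0 m A); [|assumption].
  apply (derivable_axiom r_taut); [|now constructor].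
  split; [exact (derivable_lc _ _ der_A)|assumption].
Qed.

(** * Entailment from a list of hypotheses *)

Definition top : formula := cI ≐ cI ⊃ cI ≐ cI.

Definition conj (G : list formula) : formula := fold_right And top G.

Definition entails (G : list formula) (m : nat) (A : formula) : Prop :=
  derivable m (conj G ⊃ A).

Notation "G ⊢[ m ] A" := (entails G m A) (at level 90, m at level 200).

Notation closed_context := (Forall (lc_formula 0)).

Lemma lc_conj G : lc_formula 0 (conj G) <-> closed_context G.
Proof.
  induction G as [|A G IH]; simpl.
  - split; [constructor|tauto].
  - rewrite IH, Forall_cons_iff; tauto.
Qed.

Lemma eval_conj v G : eval_prop v (conj G) = forallb (eval_prop v) G.
Proof.
  induction G as [|A G IH]; simpl; [now destruct (v _)|now rewrite IH].
Qed.

Lemma tautology_conj_incl G G' : incl G G' -> tautology (conj G' ⊃ conj G).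
Proof.
  intros G_incl v; simpl; rewrite !eval_conj.
  destruct (forallb (eval_prop v) G') eqn:all_G'; [simpl|reflexivity].
  rewrite forallb_forall in all_G' |- *.
  intros A A_in; now apply all_G', G_incl.
Qed.

Lemma lc_imp_list G A :
  lc_formula 0 (imp_list G A) <-> closed_context G /\ lc_formula 0 A.
Proof.
  induction G as [|B G IH]; simpl.
  - split; [now split|tauto].
  - rewrite IH, Forall_cons_iff; tauto.
Qed.

Lemma eval_imp_list v G A :
  eval_prop v (imp_list G A) = eval_prop v (conj G ⊃ A).
Proof.
  induction G as [|B G IH]; simpl; [now destruct (v _)|].
  rewrite IH; simpl; now destruct (eval_prop v B).
Qed.

Ltac taut :=
  let v := fresh "v" in intro v; simpl;
  repeat match goal with
         | |- context [eval_prop v ?A] => destruct (eval_prop v A)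
         | |- context [v ?A] => destruct (v A)
         end; reflexivity.

Section Entailment.

Variable G : list formula.

Lemma entails_lc m A : G ⊢[m] A -> lc_formula 0 A.
Proof. intro ent_A; apply derivable_lc in ent_A; apply ent_A. Qed.

Lemma entails_closed_context m A : G ⊢[m] A -> closed_context G.
Proof. intro ent_A; apply lc_conj; apply derivable_lc in ent_A; apply ent_A. Qed.

Lemma entails_le m m' A : m <= m' -> G ⊢[m] A -> G ⊢[m'] A.
Proof. apply derivable_le. Qed.

Lemma derivable_imp_list m A : G ⊢[m] A -> derivable m (imp_list G A).
Proof.
  intro ent_A; apply derivable_consequence with (3 := ent_A).
  - apply lc_imp_list; split.
    + exact (entails_closed_context _ _ ent_A).
    + exact (entails_lc _ _ ent_A).
  - intro v; simpl; rewrite eval_imp_list; apply implb_same.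
Qed.

Lemma entails_derivable m A : closed_context G -> derivable m A -> G ⊢[m] A.
Proof.
  intros closed_G der_A; apply derivable_consequence with (3 := der_A); [|taut].
  split; [now apply lc_conj|exact (derivable_lc _ _ der_A)].
Qed.

Lemma entails_intro m A B : A :: G ⊢[m] B -> G ⊢[m] A ⊃ B.
Proof.
  intro ent_B; apply derivable_consequence with (3 := ent_B); [|taut].
  apply derivable_lc in ent_B; simpl in *; tauto.
Qed.

Lemma entails_mp m n A B : G ⊢[m] A ⊃ B -> G ⊢[n] A -> G ⊢[m + n] B.
Proof.
  intros ent_AB; apply derivable_mp.
  apply derivable_consequence with (3 := ent_AB); [|taut].
  apply derivable_lc in ent_AB; simpl in *; tauto.
Qed.

Lemma entails_weaken G' m A :
  incl G G' -> closed_context G' -> G ⊢[m] A -> G' ⊢[m] A.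
Proof.
  intros G_incl closed_G' ent_A.
  apply derivable_consequence with (3 := ent_A).
  - split; [now apply lc_conj|exact (entails_lc _ _ ent_A)].
  - intro v; assert (conj_le := tautology_conj_incl _ _ G_incl v).
    simpl in *; destruct (eval_prop v (conj G')); simpl in *.
    + rewrite conj_le; apply implb_same.
    + apply implb_true_r.
Qed.

Lemma entails_all_elim m A t :
  lc_term 0 t -> G ⊢[m] All A -> G ⊢[S m] inst A t.
Proof.
  intros lc_t ent_A; apply (entails_mp 1 m (All A)); [|assumption].
  apply entails_derivable; [exact (entails_closed_context _ _ ent_A)|].
  apply (derivable_axiom r_all_elim); [|now constructor].
  apply entails_lc in ent_A.
  split; [assumption|now apply lc_subst].
Qed.

Lemma entails_all_intro m A :
  (forall a, G ⊢[m] inst A (Free a)) -> G ⊢[m] All A.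
Proof.
  intro ent_A; destruct (fresh_variable (conj G ⊃ All A)) as [a a_fresh].
  apply derivable_all with a; [|assumption|apply ent_A].
  split; [now apply lc_conj, (entails_closed_context m (inst A (Free a)))|].
  apply (lc_subst (Free a)); [exact I|exact (entails_lc _ _ (ent_A a))].
Qed.

Lemma entails_equality A :
  closed_context G -> lc_formula 0 A -> equality_axiom A -> G ⊢[0] A.
Proof.
  intros closed_G lc_A eq_A; apply entails_derivable; [assumption|].
  apply (derivable_axiom r_equality); [assumption|now constructor].
Qed.

Lemma entails_refl t : closed_context G -> lc_term 0 t -> G ⊢[0] t ≐ t.
Proof. intros; apply entails_equality; [assumption|now split|constructor]. Qed.

Lemma entails_sym m s t : G ⊢[m] s ≐ t -> G ⊢[m] t ≐ s.
Proof.
  intro ent_st; apply (entails_mp 0 m (s ≐ t)); [|assumption].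
  apply entails_equality;
    [exact (entails_closed_context _ _ ent_st)| |constructor].
  apply entails_lc in ent_st; simpl in *; tauto.
Qed.

Lemma entails_trans m n s t u :
  G ⊢[m] s ≐ t -> G ⊢[n] t ≐ u -> G ⊢[m + n] s ≐ u.
Proof.
  intros ent_st ent_tu; apply entails_mp with (t ≐ u); [|assumption].
  apply (entails_mp 0 m (s ≐ t)); [|assumption].
  apply entails_equality;
    [exact (entails_closed_context _ _ ent_st)| |constructor].
  apply entails_lc in ent_st, ent_tu; simpl in *; tauto.
Qed.

Lemma entails_app m n s t u w :
  G ⊢[m] s ≐ t -> G ⊢[n] u ≐ w -> G ⊢[m + n] s ∘ u ≐ t ∘ w.
Proof.
  intros ent_st ent_uw; apply entails_mp with (u ≐ w); [|assumption].
  apply (entails_mp 0 m (s ≐ t)); [|assumption].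
  apply entails_equality;
    [exact (entails_closed_context _ _ ent_st)| |constructor].
  apply entails_lc in ent_st, ent_uw; simpl in *; tauto.
Qed.

Lemma entails_app_l m s t u :
  lc_term 0 u -> G ⊢[m] s ≐ t -> G ⊢[m] s ∘ u ≐ t ∘ u.
Proof.
  intros lc_u ent_st; rewrite <- (Nat.add_0_r m).
  apply entails_app; [assumption|].
  apply entails_refl; [exact (entails_closed_context _ _ ent_st)|assumption].
Qed.

Lemma entails_app_r m s t u :
  lc_term 0 u -> G ⊢[m] s ≐ t -> G ⊢[m] u ∘ s ≐ u ∘ t.
Proof.
  intros lc_u ent_st; apply (entails_app 0); [|assumption].
  apply entails_refl; [exact (entails_closed_context _ _ ent_st)|assumption].
Qed.

End Entailment.

Lemma entails_hyp G A : closed_context G -> In A G -> G ⊢[0] A.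
Proof.
  intros closed_G A_in; apply entails_weaken with [A];
    [now intros ? [<-|[]]|assumption|].
  apply (derivable_axiom r_taut); [|constructor; taut].
  rewrite Forall_forall in closed_G; specialize (closed_G _ A_in).
  simpl; tauto.
Qed.

Lemma entails_all3_elim G m A s t u :
  lc_term 0 s -> lc_term 0 t -> lc_term 0 u -> G ⊢[m] All (All (All A)) ->
  G ⊢[S (S (S m))] subst 0 u (subst 1 t (subst 2 s A)).
Proof.
  intros lc_s lc_t lc_u ent_A.
  apply (entails_all_elim _ _ _ s lc_s) in ent_A.
  apply (entails_all_elim _ _ _ t lc_t) in ent_A.
  exact (entails_all_elim _ _ _ u lc_u ent_A).
Qed.

(** * Combinators *)

Section Combinators.

Variable G : list formula.
Hypothesis closed_G : closed_context G.
Hypothesis G_lambdaI : incl all_lambdaI G.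

Lemma entails_all_lambdaI i A : nth_error all_lambdaI i = Some A -> G ⊢[0] A.
Proof.
  intro nth_i; apply entails_hyp; [assumption|].
  apply G_lambdaI; exact (nth_error_In _ _ nth_i).
Qed.

Section Equations.

Variables s t u : term.
Hypotheses (lc_s : lc_term 0 s) (lc_t : lc_term 0 t) (lc_u : lc_term 0 u).

Ltac all_lambdaI_instance i :=
  generalize (entails_all3_elim _ _ _ s t u lc_s lc_t lc_u
    (entails_all_lambdaI i _ eq_refl)); simpl;
  now rewrite !(subst_closed_term _ _ s), !(subst_closed_term _ _ t).

Lemma entails_S : G ⊢[3] cS ∘ s ∘ t ∘ u ≐ s ∘ u ∘ (t ∘ u).
Proof. all_lambdaI_instance 0. Qed.

Lemma entails_B : G ⊢[3] cB ∘ s ∘ t ∘ u ≐ s ∘ (t ∘ u).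
Proof. all_lambdaI_instance 1. Qed.

Lemma entails_C : G ⊢[3] cC ∘ s ∘ t ∘ u ≐ s ∘ u ∘ t.
Proof. all_lambdaI_instance 2. Qed.

Lemma entails_I : G ⊢[1] cI ∘ s ≐ s.
Proof.
  exact (entails_all_elim _ _ _ s lc_s (entails_all_lambdaI 3 _ eq_refl)).
Qed.

End Equations.

Lemma entails_CBI s t :
  lc_term 0 s -> lc_term 0 t -> G ⊢[7] cC ∘ cB ∘ cI ∘ s ∘ t ≐ s ∘ t.
Proof.
  intros lc_s lc_t.
  apply (entails_trans _ 3 4) with (cB ∘ s ∘ cI ∘ t).
  { apply entails_app_l; [assumption|now apply entails_C]. }
  apply (entails_trans _ 3 1) with (s ∘ (cI ∘ t)); [now apply entails_B|].
  apply entails_app_r; [assumption|now apply entails_I].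
Qed.

Lemma entails_T s t :
  lc_term 0 s -> lc_term 0 t -> G ⊢[13] T ∘ s ∘ t ≐ s ∘ (s ∘ t).
Proof.
  intros lc_s lc_t.
  apply (entails_trans _ 3 10) with (cB ∘ s ∘ (cC ∘ cB ∘ cI ∘ s) ∘ t).
  { apply entails_app_l; [assumption|apply entails_S; simpl; tauto]. }
  apply (entails_trans _ 3 7) with (s ∘ (cC ∘ cB ∘ cI ∘ s ∘ t)).
  { apply entails_B; simpl; tauto. }
  apply entails_app_r; [assumption|now apply entails_CBI].
Qed.

End Combinators.

(** * Hereditary terms *)

Definition preserves_matrix (P : term -> formula) (y : term) : formula :=
  P (Bound 1) ⊃ lift (lift y) ∘ Bound 1 ≐ Bound 0 ⊃ P (Bound 0).

Fixpoint hereditary (k : nat) (y : term) : formula :=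
  match k with
  | 0 => All (cp ∘ Bound 0 ≐ cp ∘ (lift y ∘ Bound 0))
  | S k => All (All (preserves_matrix (hereditary k) y))
  end.

Lemma lc_hereditary k : forall j y,
  lc_formula j (hereditary k y) <-> lc_term j y.
Proof.
  induction k as [|k IH]; intros j y; simpl.
  - rewrite lc_lift; intuition lia.
  - rewrite !IH, !lc_lift; simpl; intuition lia.
Qed.

Lemma subst_hereditary u k : lc_term 0 u -> forall j y,
  subst j u (hereditary k y) = hereditary k (subst_term j u y).
Proof.
  intro lc_u; induction k as [|k IH]; intros j y; simpl.
  - now rewrite subst_lift.
  - rewrite !IH, !subst_lift by assumption; reflexivity.
Qed.

Lemma hereditary_0_elim G m y t :
  lc_term 0 t -> G ⊢[m] hereditary 0 y -> G ⊢[S m] cp ∘ t ≐ cp ∘ (y ∘ t).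
Proof.
  intros lc_t her_y.
  assert (lc_y : lc_term 0 y)
    by exact (proj1 (lc_hereditary _ _ _) (entails_lc _ _ _ her_y)).
  apply (entails_all_elim _ _ _ t lc_t) in her_y; unfold inst in her_y.
  simpl in her_y; now rewrite lift_lc, subst_closed_term in her_y.
Qed.

Lemma hereditary_0_intro G m y :
  lc_term 0 y -> (forall a, G ⊢[m] cp ∘ Free a ≐ cp ∘ (y ∘ Free a)) ->
  G ⊢[m] hereditary 0 y.
Proof.
  intros lc_y her_y; apply entails_all_intro; intro a; unfold inst; simpl.
  now rewrite lift_lc, subst_closed_term.
Qed.

Lemma inst_preserves_matrix k y s t :
  lc_term 0 y -> lc_term 0 s -> lc_term 0 t ->
  inst (subst 1 s (preserves_matrix (hereditary k) y)) t =
  (hereditary k s ⊃ y ∘ s ≐ t ⊃ hereditary k t).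
Proof.
  intros lc_y lc_s lc_t; unfold inst, preserves_matrix; simpl.
  rewrite !subst_hereditary by assumption; simpl.
  rewrite !(lift_lc y) by assumption.
  now rewrite !(subst_closed_term _ _ y), (subst_closed_term _ _ s).
Qed.

Lemma hereditary_S_elim G k l m n y s t :
  G ⊢[l] hereditary (S k) y -> G ⊢[m] hereditary k s -> G ⊢[n] y ∘ s ≐ t ->
  G ⊢[S (S l) + m + n] hereditary k t.
Proof.
  intros her_y her_s eq_t.
  destruct (entails_lc _ _ _ eq_t) as [[lc_y lc_s] lc_t].
  apply entails_mp with (y ∘ s ≐ t); [|assumption].
  apply entails_mp with (hereditary k s); [|assumption].
  rewrite <- inst_preserves_matrix by assumption.
  apply (entails_all_elim _ _ _ s lc_s) in her_y.
  exact (entails_all_elim _ _ _ t lc_t her_y).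
Qed.

Lemma hereditary_app G k m n y s :
  G ⊢[m] hereditary (S k) y -> G ⊢[n] hereditary k s ->
  G ⊢[S (S m) + n] hereditary k (y ∘ s).
Proof.
  intros her_y her_s; rewrite <- (Nat.add_0_r (S (S m) + n)).
  apply hereditary_S_elim with (2 := her_s) (1 := her_y).
  apply entails_refl; [exact (entails_closed_context _ _ _ her_y)|].
  split; eapply lc_hereditary, entails_lc; eassumption.
Qed.

(* Ranging over all extensions [G'] of [G] hides the form of the two hypotheses
   that the proof adds to [G]. *)
Lemma hereditary_S_intro G k m y :
  closed_context G -> lc_term 0 y ->
  (forall G' a b, incl G G' -> G' ⊢[0] hereditary k (Free a) ->
     G' ⊢[0] y ∘ Free a ≐ Free b -> G' ⊢[m] hereditary k (Free b)) ->
  G ⊢[m] hereditary (S k) y.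
Proof.
  intros closed_G lc_y her_y.
  apply entails_all_intro; intro a; apply entails_all_intro; intro b.
  rewrite inst_preserves_matrix by easy; do 2 apply entails_intro.
  assert (closed_G' : closed_context
    ((y ∘ Free a ≐ Free b) :: hereditary k (Free a) :: G)).
  { constructor; [simpl; tauto|].
    constructor; [now apply lc_hereditary|assumption]. }
  apply her_y with a; [now do 2 apply incl_tl| |];
    (apply entails_hyp; [assumption|simpl; tauto]).
Qed.

Lemma entails_T_app G m y v t :
  incl all_lambdaI G -> lc_term 0 t -> G ⊢[m] T ∘ y ≐ v ->
  G ⊢[13 + m] y ∘ (y ∘ t) ≐ v ∘ t.
Proof.
  intros G_lambdaI lc_t eq_v; destruct (entails_lc _ _ _ eq_v) as [[_ lc_y] _].
  apply entails_trans with (T ∘ y ∘ t); [|now apply entails_app_l].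
  apply entails_sym, entails_T; try assumption.
  exact (entails_closed_context _ _ _ eq_v).
Qed.

Lemma hereditary_double G k m n y v :
  incl all_lambdaI G -> G ⊢[m] hereditary k y -> G ⊢[n] T ∘ y ≐ v ->
  G ⊢[2 * m + n + 17] hereditary k v.
Proof.
  intros G_lambdaI her_y eq_v.
  destruct (entails_lc _ _ _ eq_v) as [[_ lc_y] lc_v].
  destruct k as [|k].
  - apply hereditary_0_intro; [assumption|intro a].
    apply entails_le with (S m + (S m + (13 + n))); [lia|].
    apply entails_trans with (cp ∘ (y ∘ Free a)).
    { now apply hereditary_0_elim. }
    apply entails_trans with (cp ∘ (y ∘ (y ∘ Free a))).
    { now apply hereditary_0_elim; [split|]. }
    apply entails_app_r; [exact I|now apply entails_T_app].
  - apply hereditary_S_intro; [|assumption|].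
    { exact (entails_closed_context _ _ _ eq_v). }
    intros G' a b G_incl her_a eq_b.
    assert (closed_G' := entails_closed_context _ _ _ eq_b).
    apply entails_weaken with (G' := G') in her_y, eq_v; try assumption.
    apply entails_le with (S (S m) + (S (S m) + 0) + (13 + n + 0)); [lia|].
    apply hereditary_S_elim with y (y ∘ Free a).
    + assumption.
    + now apply hereditary_app.
    + apply entails_trans with (v ∘ Free a); [|assumption].
      apply entails_T_app; [|exact I|assumption].
      now apply incl_tran with G.
Qed.

Lemma hereditary_S_T G k :
  closed_context G -> incl all_lambdaI G -> G ⊢[17] hereditary (S k) T.
Proof.
  intros closed_G G_lambdaI.
  apply hereditary_S_intro; [assumption|simpl; tauto|].
  intros G' a b G_incl her_a eq_b.
  apply (hereditary_double _ _ 0 0) with (Free a); try assumption.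
  now apply incl_tran with G.
Qed.

Lemma hereditary_S_Tn G i : closed_context G -> incl all_lambdaI G ->
  forall k, G ⊢[19 * i + 17] hereditary (S k) (Tn (S i)).
Proof.
  intros closed_G G_lambdaI; induction i as [|i IH]; intro k.
  - now apply hereditary_S_T.
  - apply entails_le with (S (S (19 * i + 17)) + 17); [lia|].
    apply hereditary_app; [apply IH|now apply hereditary_S_T].
Qed.

Theorem mainTheorem5 :
  exists c d : nat, forall n : nat, 1 <= n ->
    exists pi : proof,
      proves pi (imp_list all_lambdaI (Imp p_invariant (E n))) /\
      cc pi <= c * n + d.
Proof.
  exists 19, 1; intros [|i] n_pos; [lia|].
  set (G := all_lambdaI ++ [p_invariant]).
  assert (closed_G : closed_context G).
  { repeat constructor. }
  assert (her_q : G ⊢[0] hereditary 0 cq).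
  { apply (entails_hyp G p_invariant); [assumption|].
    apply in_or_app; right; now left. }
  assert (her_Tn : G ⊢[19 * i + 17] hereditary 1 (Tn (S i))).
  { apply hereditary_S_Tn; [assumption|apply incl_appl, incl_refl]. }
  assert (ent_E : G ⊢[S (S (S (19 * i + 17)) + 0)] E (S i)).
  { apply hereditary_0_elim; [exact I|now apply hereditary_app]. }
  apply (derivable_imp_list G), derivable_le with (2 := ent_E); lia.
Qed.
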